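(* For $\mu=(\mu_1,\mu_2,\mu_3)\in\mathbb{R}^3$ let $L_\mu$ be the real Lie algebra on $\mathbb{R}^3$ with $[e_1,e_2]=\mu_3e_3$, $[e_2,e_3]=\mu_1e_1$, $[e_3,e_1]=\mu_2e_2$. Then the automorphism group $H\subseteq \mathrm{GL}_3(\mathbb{R})$ of $L_\mu$, and the dimension of the $\mathrm{GL}_3(\mathbb{R})$-orbit $B$ of its bracket in $\Lambda^2(\mathbb{R}^3)^*\otimes\mathbb{R}^3$, are as follows. \begin{itemize} \item $\mu=(0,0,0)$ (Bianchi $I$): $H=\mathrm{GL}_3(\mathbb{R})$, $\dim B=0$. \item $\mu=(1,0,0)$ (Bianchi $II$): $H=\left\{\begin{pmatrix}\det(g_2)&c\\0&g_2\end{pmatrix}: g_2\in \mathrm{GL}_2(\mathbb{R}),\ c\in\mathbb{R}^{1\times 2}\right\}$, $\dim B=3$. \item $\mu=(1,-1,0)$ (Bianchi $VI_0$): $H=\left\{\begin{pmatrix}g_1&c\\0&\lambda(g_1)/\det(g_1)\end{pmatrix}: g_1\in \mathrm{CO}(1,1),\ c\in\mathbb{R}^{2\times 1}\right\}$, $\dim B=5$. \item $\mu=(1,1,0)$ (Bianchi $VII_0$): $H=\left\{\begin{pmatrix}g_1&c\\0&\mathrm{sgn}(\det g_1)\end{pmatrix}: g_1\in \mathrm{CO}(2),\ c\in\mathbb{R}^{2\times 1}\right\}$, $\dim B=5$. \item $\mu=(1,1,-1)$ (Bianchi $VIII$): $H=\mathrm{SO}(2,1)$, $\dim B=6$. \item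 $\mu=(1,1,1)$ (Bianchi $IX$): $H=\mathrm{SO}(3)$, $\dim B=6$. \end{itemize}
   Context: A matrix $g=(g^i_j)\in\mathrm{GL}_3(\mathbb{R})$ acts on $\mathbb{R}^3$ by $g e_j=\sum_i g^i_j e_i$. The group $\mathrm{GL}_3(\mathbb{R})$ acts on skew-symmetric bilinear maps $C:\mathbb{R}^3\times\mathbb{R}^3\to\mathbb{R}^3$ (identified with elements of $\Lambda^2(\mathbb{R}^3)^*\otimes\mathbb{R}^3$) by $(g.C)(a,b)=g\,C(g^{-1}a,g^{-1}b)$. The automorphism group of a bracket is its stabilizer. The orbit of $C$ with stabilizer $H$ carries the manifold structure of $\mathrm{GL}_3(\mathbb{R})/H$, so its dimension is $9-\dim H$. Let $I_{1,1}=\mathrm{diag}(1,-1)$, $I_{2,1}=\mathrm{diag}(1,1,-1)$ and let $I_2$ be the $2\times2$ identity. Then $\mathrm{CO}(1,1)=\{g_1\in \mathrm{GL}_2(\mathbb{R}):\exists\lambda\in\mathbb{R}\setminus\{0\},\ g_1I_{1,1}g_1^T=\lambda I_{1,1}\}$, and $\lambda(g_1)$ denotes the unique such $\lambda$. Further $\mathrm{CO}(2)=\{g_1\in \mathrm{GL}_2(\mathbb{R}):\exists\lambda\in\mathbb{R}\setminus\{0\},\ g_1g_1^T=\lambda I_2\}$, and $\mathrm{SO}(2,1)=\{g\in \mathrm{GL}_3(\mathbb{R}): gI_{2,1}g^T=I_{2,1},\ \det g=1\}$. *)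

(* Defs.v *)
From mathcomp Require Export all_boot all_order all_algebra.
From mathcomp Require Export all_classical all_reals all_analysis.
From mathcomp Require Import ring.
Export Order.TTheory GRing.Theory Num.Theory numFieldNormedType.Exports.

Set Implicit Arguments.
Unset Strict Implicit.
Unset Printing Implicit Defensive.

Local Open Scope classical_set_scope.
Local Open Scope ring_scope.

Section Submanifold.
Context {R : realType}.

(* Over a finite-dimensional [U], iterating directional derivatives in all
   directions gives the usual classes C^k; [V] is meant to be open. *)
Fixpoint class_C {U W : normedModType R} (k : nat) (V : set U) (f : U -> W)
    : Prop :=
  (forall x, V x -> {for x, continuous f}) /\
  if k is k'.+1 then
    forall v : U, (forall x, V x -> derivable f x v) /\
                  class_C k' V (fun x => 'D_v f x)
  else True.

Definition smooth_on {U W : normedModType R} (V : set U) (f : U -> W) : Prop :=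
  forall k, class_C k V f.

(* [M] is a smooth embedded submanifold of [W], of dimension [k]: near each of
   its points it is parametrized by a smooth immersion of an open subset of R^k
   that is a homeomorphism onto an open subset of [M] (subspace topology). *)
Definition submanifold {W : normedModType R} (k : nat) (M : set W) : Prop :=
  forall p, M p ->
  exists (O : set W) (V : set 'rV[R]_k) (psi : 'rV[R]_k -> W)
         (phi : W -> 'rV[R]_k),
    [/\ open O /\ O p,
        open V,
        smooth_on V psi,
        forall x v, V x -> 'D_v psi x = 0 -> v = 0 &
        [/\ psi @` V = M `&` O,
            forall x, V x -> phi (psi x) = x &
            {within M `&` O, continuous phi}]].

End Submanifold.

Section Brackets.
Context {R : realType}.

Definition GL (n : nat) : set 'M[R]_n := [set g | g \in unitmx].

Definition bracket := 'cV[R]_3 -> 'cV[R]_3 -> 'cV[R]_3.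

(* The elements of Lambda^2(R^3)^* (x) R^3. *)
Definition skew_bilinear (C : bracket) : Prop :=
  bilinear_for *:%R *:%R C /\ forall a b, C a b = - C b a.

Definition lie_bracket (C : bracket) : Prop :=
  skew_bilinear C /\
  forall a b c, C a (C b c) + C b (C c a) + C c (C a b) = 0.

Definition act (g : 'M[R]_3) (C : bracket) : bracket :=
  fun a b => g *m C (invmx g *m a) (invmx g *m b).

Definition Aut (C : bracket) : set 'M[R]_3 :=
  [set g | GL g /\ act g C = C].

Definition orbit (C : bracket) : set bracket :=
  [set D | exists2 g, GL g & D = act g C].

(* An orbit carries the manifold structure of GL_3(R) / H, with H the
   stabilizer of any of its points: dim B = 9 - dim H, where the closed subgroup
   H of GL_3(R) is an embedded submanifold of the space of 3 x 3 matrices. *)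
Definition orbit_dim (B : set bracket) (d : nat) : Prop :=
  exists (C : bracket) (k : nat),
    [/\ B = orbit C, submanifold k (Aut C) & (d + k = 9)%N].

(* [e_ i] for i = 0, 1, 2 is the standard basis vector e_{i+1}. *)
Definition e_ (i : 'I_3) : 'cV[R]_3 := delta_mx i 0.

(* The skew-symmetric bilinear extension of
   [e1,e2] = m3 e3, [e2,e3] = m1 e1, [e3,e1] = m2 e2; see [bianchi_e]. *)
Definition bianchi (m1 m2 m3 : R) : bracket := fun a b =>
  let x (u : 'cV[R]_3) (i : 'I_3) := u i 0 in
  let i1 : 'I_3 := inord 0 in let i2 : 'I_3 := inord 1 in
  let i3 : 'I_3 := inord 2 in
    (m1 * (x a i2 * x b i3 - x a i3 * x b i2)) *: e_ i1
  + (m2 * (x a i3 * x b i1 - x a i1 * x b i3)) *: e_ i2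
  + (m3 * (x a i1 * x b i2 - x a i2 * x b i1)) *: e_ i3.

Lemma act_skew_bilinear g C : skew_bilinear C -> skew_bilinear (act g C).
Proof.
move=> [[Cl Cr] Cs]; split; last first.
  by move=> a b; rewrite /act Cs mulmxN.
split=> [b k a a'|a k b b']; rewrite /act mulmxDr -scalemxAr.
  by rewrite Cl mulmxDr -scalemxAr.
by rewrite Cr mulmxDr -scalemxAr.
Qed.

Lemma bianchi_lie m1 m2 m3 : lie_bracket (bianchi m1 m2 m3).
Proof.
have e3 (P : 'I_3 -> Prop) :
  P (inord 0) -> P (inord 1) -> P (inord 2) -> forall i, P i.
  move=> P0 P1 P2 i; rewrite -(inord_val i).
  by case: i => [[|[|[|n]]] ni].
have E m n : (m < 3)%N -> (n < 3)%N ->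
  ((inord m : 'I_3) == inord n) = (m == n).
  by move=> m3' n3; rewrite -val_eqE /= !inordK.
split; first split; first split.
- by move=> b k a a'; apply/matrixP; elim/e3=> j; rewrite !mxE !E //=; ring.
- by move=> b k a a'; apply/matrixP; elim/e3=> j; rewrite !mxE !E //=; ring.
- by move=> a b; apply/matrixP; elim/e3=> j; rewrite !mxE !E //=; ring.
by move=> a b c; apply/matrixP; elim/e3=> j; rewrite (ord1 j) !mxE !E //=; ring.
Qed.

Lemma bianchi_e m1 m2 m3 :
  let L := bianchi m1 m2 m3 in
  let e1 := e_ (inord 0) in let e2 := e_ (inord 1) in let e3 := e_ (inord 2) in
  [/\ L e1 e2 = m3 *: e3, L e2 e3 = m1 *: e1 & L e3 e1 = m2 *: e2].
Proof.
have E m n : (m < 3)%N -> (n < 3)%N ->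
  ((inord m : 'I_3) == inord n) = (m == n).
  by move=> m3' n3; rewrite -val_eqE /= !inordK.
by split; apply/matrixP => i j; rewrite !mxE !E //=; ring.
Qed.

(* I_{p,q} = diag(1, ..., 1, -1, ..., -1) *)
Definition I_ (p q : nat) : 'M[R]_(p + q) := block_mx 1%:M 0 0 (- 1%:M).

Definition is_factor (g : 'M[R]_2) (l : R) : Prop :=
  l != 0 /\ g *m I_ 1 1 *m g^T = l *: I_ 1 1.

Definition CO11 : set 'M[R]_2 :=
  [set g | GL g /\ exists l, is_factor g l].

(* lambda(g), for g in CO(1,1) (and 0 elsewhere); see [lambdaP]. *)
Definition lambda (g : 'M[R]_2) : R := xget 0 [set l | is_factor g l].

Definition CO2 : set 'M[R]_2 :=
  [set g | GL g /\ exists l : R, l != 0 /\ g *m g^T = l *: 1%:M].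

Definition SO21 : set 'M[R]_3 :=
  [set g | [/\ GL g, g *m I_ 2 1 *m g^T = I_ 2 1 & \det g = 1]].

Definition SO3 : set 'M[R]_3 :=
  [set g | [/\ GL g, g *m g^T = 1%:M & \det g = 1]].

Lemma lambdaP g l : is_factor g l -> lambda g = l.
Proof.
move=> gl; rewrite /lambda; case: xgetP => [l' _ [_ gl']|/(_ l)] //.
case: gl => _; rewrite gl' => /matrixP/(_ 0 0).
by rewrite /I_ !mxE; case: splitP => // j _; rewrite !mxE; case: splitP => // j' _;
  rewrite !mxE !ord1 /= !mulr1.
Qed.

End Brackets.

Arguments GL : clear implicits.
Arguments CO11 : clear implicits.
Arguments CO2 : clear implicits.
Arguments SO21 : clear implicits.
Arguments SO3 : clear implicits.

(* Main.v *)
From mathcomp Require Import ring lra.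
Require Import Defs.

Set Implicit Arguments.
Unset Strict Implicit.
Unset Printing Implicit Defensive.

Local Open Scope classical_set_scope.
Local Open Scope ring_scope.

(* With D = diag(m1, m2, m3) the bracket is C(a, b) = D (a x b), and
   g^T (ga x gb) = det(g) (a x b) gives (g.C)(a, b) = det(g)^-1 g D g^T (a x b):
   the automorphisms are the g with g D g^T = det(g) D. For I, II, VI_0 and VII_0
   these equations are solved explicitly, which parametrizes each component of the
   automorphism group globally by polynomials. For VIII and IX they reduce to
   g D g^T = D and det(g) = 1, and the Cayley transform, translated by p, is a
   chart around p defined where 1 + tr(p^-1 g) != 0. *)

(** No implicit function theorem enters: every chart comes with an explicit polynomial or rational
    inverse, which is why the Cayley transform is preferred to the exponential. Its domain has this
    origin: if g preserves J = diag(1, 1, e), e = 1 or -1, and det(g) = 1, then g^-1 is conjugate to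
    g^T, so the characteristic polynomial is x^3 - t x^2 + t x - 1 with t = tr(g), and det(1 + g) =
    2 (1 + t). Thus 1 + t != 0 says exactly that 1 + g is invertible. The factor det(g) in the
    equation for automorphisms behaves in two ways. For invertible D, taking determinants forces it
    to be 1; for degenerate D it survives, and becomes the conformal factor of VI_0 and VII_0. A
    symbolic sign e with e^2 = 1 lets one argument serve VI_0 and VII_0, and another serve VIII and
    IX. *)

Section ClassC.
Context {R : realType} {U : normedModType R}.
Implicit Types (V : set U) (k : nat).

Lemma cvg_mxP (T : Type) (F : set_system T) {FF : Filter F} m n
    (f : T -> 'M[R]_(m, n)) (l : 'M[R]_(m, n)) :
  (forall i j, f x i j @[x --> F] --> l i j) -> f @ F --> l.
Proof.
move=> fl; apply/cvgrPdist_le => e e0; near=> x.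
rewrite /Num.Def.normr/= mx_normrE (bigmax_le _ (ltW e0))//= => i _.
rewrite !mxE/=; move: i; near: x; apply: filter_forall => /= i.
exact: ((cvgrPdist_le _ _).1 (fl i.1 i.2)).
Unshelve. all: by end_near. Qed.

(** The rules for derivatives of sums, products and inverses are available only at points of [V], so
    functions must be exchangeable as soon as they agree on [V]. Since [V] is open, they then agree
    near each of its points and have the same limits and derivatives there. *)
Lemma class_C_eq {W : normedModType R} k V (f g : U -> W) :
  open V -> {in V, f =1 g} -> class_C k V f -> class_C k V g.
Proof.
move=> oV; have near_eq (f' g' : U -> W) x : {in V, f' =1 g'} -> V x ->
    {near x, f' =1 g'}.
  move=> fg Vx; near=> y; apply: fg; apply/mem_set; near: y.
  exact: open_nbhs_nbhs.
elim: k f g => [|k IHk] f g fg [fc fd]; split=> //.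
- move=> x Vx; rewrite /prop_for /continuous_at -(fg x) ?inE//.
  exact: cvg_trans (near_eq_cvg (near_eq _ _ _ fg Vx)) (fc x Vx).
- move=> x Vx; rewrite /prop_for /continuous_at -(fg x) ?inE//.
  exact: cvg_trans (near_eq_cvg (near_eq _ _ _ fg Vx)) (fc x Vx).
move=> v; have [fdv fdk] := fd v; split.
  by move=> x Vx; apply: near_eq_derivable (near_eq _ _ _ fg Vx) (fdv x Vx).
apply: IHk fdk => x /set_mem Vx.
exact: near_eq_derive (near_eq _ _ _ fg Vx).
Unshelve. all: by end_near. Qed.

Lemma class_C_subset {W : normedModType R} k V V' (f : U -> W) :
  V `<=` V' -> class_C k V' f -> class_C k V f.
Proof.
move=> VV'; elim: k f => [|k IHk] f [fc fd]; split=> //;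
  try by move=> x /VV'; exact: fc.
move=> v; have [fdv fdk] := fd v; split; last exact: IHk.
by move=> x /VV'; exact: fdv.
Qed.

Lemma class_CS {W : normedModType R} k V (f : U -> W) :
  class_C k.+1 V f -> class_C k V f.
Proof.
elim: k f => [|k IHk] f; first by case.
by move=> [fc fd]; split=> // v; have [fdv /IHk] := fd v.
Qed.

Lemma class_C_cst {W : normedModType R} k V (c : W) : class_C k V (cst c).
Proof.
elim: k c => [|k IHk] c; split=> //; try by move=> x _; exact: cvg_cst.
move=> v; split=> [x _|]; first exact: derivable_cst.
rewrite (_ : (fun _ => _) = cst 0) //.
by apply/funext => x; rewrite derive_cst.
Qed.

Lemma class_CD {W : normedModType R} k V (f g : U -> W) : open V ->
  class_C k V f -> class_C k V g -> class_C k V (fun x => f x + g x).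
Proof.
move=> oV; elim: k f g => [|k IHk] f g [fc fd] [gc gd]; split=> //;
  try by move=> x Vx; apply: cvgD; [exact: fc|exact: gc].
move=> v; have [fdv fdk] := fd v; have [gdv gdk] := gd v; split=> [x Vx|].
  by apply: derivableD; [exact: fdv|exact: gdv].
apply: class_C_eq (IHk _ _ fdk gdk) => // x /set_mem Vx.
by rewrite [RHS]deriveD; [|exact: fdv|exact: gdv].
Qed.

Lemma class_CM k V (f g : U -> R) : open V ->
  class_C k V f -> class_C k V g -> class_C k V (fun x => f x * g x).
Proof.
move=> oV; elim: k f g => [|k IHk] f g Cf Cg; have [fc fd] := Cf;
  have [gc gd] := Cg; split=> //;
  try by move=> x Vx; apply: cvgM; [exact: fc|exact: gc].
move=> v; have [fdv fdk] := fd v; have [gdv gdk] := gd v; split=> [x Vx|].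
  by apply: derivableM; [exact: fdv|exact: gdv].
have /class_C_eq : class_C k V (fun x => f x * 'D_v g x + g x * 'D_v f x).
  by apply: class_CD => //; apply: IHk => //; exact: class_CS.
apply=> // x /set_mem Vx.
by rewrite [RHS]deriveM; [|exact: fdv|exact: gdv].
Qed.

(** The derivative of 1/f is expressed through 1/f itself, whose class [k] is the induction
    hypothesis; hence the induction keeps [f] fixed. *)
Lemma class_CV k V (f : U -> R) : open V -> (forall x, V x -> f x != 0) ->
  class_C k V f -> class_C k V (fun x => (f x)^-1).
Proof.
move=> oV f0; elim: k => [|k IHk] Cf; have [fc fd] := Cf; split=> //;
  try by move=> x Vx; apply: cvgV; [exact: f0|exact: fc].
move=> v; have [fdv fdk] := fd v; split=> [x Vx|].
  by apply: derivableV; [exact: f0|exact: fdv].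
have CV := IHk (class_CS Cf).
have /class_C_eq : class_C k V
    (fun x => -1 * ((f x)^-1 * (f x)^-1) * 'D_v f x).
  apply: class_CM => //; apply: class_CM => //; first exact: class_C_cst.
  exact: class_CM.
apply=> // x /set_mem Vx.
rewrite deriveV ?f0//; last exact: fdv.
by rewrite mulN1r -invfM -expr2.
Qed.

Lemma class_C_mxP k V m n (f : U -> 'M[R]_(m, n)) : open V ->
  class_C k V f <-> forall i j, class_C k V (fun x => f x i j : R).
Proof.
move=> oV; elim: k f => [|k IHk] f; split.
- case=> fc _ i j; split=> // x Vx.
  by apply: (@cvg_comp _ _ _ f (fun A : 'M[R]_(m, n) => A i j));
    [exact: fc|exact: coord_continuous].
- by move=> fc; split=> // x Vx; apply: cvg_mxP => i j; have [/(_ x Vx)] := fc i j.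
- case=> fc fd i j; split=> [x Vx|v].
    by apply: (@cvg_comp _ _ _ f (fun A : 'M[R]_(m, n) => A i j));
      [exact: fc|exact: coord_continuous].
  have [fdv /IHk/(_ i j) fdk] := fd v; split=> [x /fdv/derivable_mxP//|].
  apply: class_C_eq fdk => // x /set_mem/fdv fx.
  by rewrite derive_mx// mxE.
- move=> fc; split=> [x Vx|v].
    by apply: cvg_mxP => i j; have [/(_ x Vx)] := fc i j.
  have fdv x : V x -> derivable f x v.
    by move=> Vx; apply/derivable_mxP => i j; have [_ /(_ v)[/(_ x Vx)]] := fc i j.
  split=> //; apply/IHk => i j; have [_ /(_ v)[_]] := fc i j.
  apply: class_C_eq => // x /set_mem/fdv fx.
  by rewrite derive_mx// mxE.
Qed.

End ClassC.

(** * Chain rule along a direction and a criterion for embedded submanifolds *)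

Section Chart.
Context {R : realType}.

Lemma class_C_coord k m n (V : set 'M[R]_(m, n)) i j :
  class_C k V (fun x : 'M[R]_(m, n) => x i j : R).
Proof.
case: k => [|k]; split=> //; try by move=> x _; exact: coord_continuous.
have D (v x : 'M[R]_(m, n)) :
    is_derive x v (fun y : 'M[R]_(m, n) => y i j : R) (v i j).
  (* The derivative of an entry is read off from the derivative of the identity, taken entrywise. *)
  have [idd idv] := is_derive_id x v.
  have -> : v i j = 'D_v (fun y : 'M[R]_(m, n) => y i j : R) x.
    by rewrite -[in LHS]idv derive_mx// mxE.
  by apply: derivableP; have /derivable_mxP := idd.
move=> v; split=> [x _|]; first by have [] := D v x.
suff -> : 'D_v (fun y : 'M[R]_(m, n) => y i j : R) = cst (v i j).
exact: class_C_cst.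
by apply/funext => x; have [_] := D v x.
Qed.

Lemma continuous_smooth {U W : normedModType R} (f : U -> W) :
  smooth_on setT f -> continuous f.
Proof. by move=> /(_ 0%N)[fc _] x; exact: fc. Qed.

Lemma derive_line {U W : normedModType R} (f : U -> W) (x v : U) :
  'D_v f x = 'D_1 (fun h : R => f (h *: v + x)) 0.
Proof.
rewrite /derive; congr (lim (_ @ 0^')); apply/funext => h /=.
by rewrite addr0 scale0r add0r [_%:A]mulr1.
Qed.

(** Derivability of [f] along [v] is weaker than differentiability. On the line through [x] in
    direction [v] the two notions coincide, and there the chain rule for differentials applies. *)
Lemma derive_comp {U W X : normedModType R} (f : U -> W) (g : W -> X) (x v : U) :
  derivable f x v -> differentiable g (f x) ->
  'D_v (g \o f) x = 'd g (f x) ('D_v f x).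
Proof.
move=> /derivable1P/derivable1_diffP df dg.
set F := fun h : R => f (h *: v + x) in df *.
have F0 : F 0 = f x by rewrite /F scale0r add0r.
have dg' : differentiable g (F 0) by rewrite F0.
have fF : 'D_v f x = 'D_(1 : R) F 0 by exact: derive_line.
apply: (etrans (derive_line (g \o f) x v)).
rewrite fF (deriveE _ df) -F0.
apply: (etrans (deriveE _ (differentiable_comp df dg'))).
by rewrite diff_comp.
Qed.

(* Differentiability of the inverse chart [phi] along [O] makes it continuous
   and, by the chain rule for [phi \o psi = id], makes [psi] an immersion. *)
Lemma submanifold_charts {W : normedModType R} k (M : set W) :
  (forall p, M p -> exists (O : set W) (V : set 'rV[R]_k)
      (psi : 'rV[R]_k -> W) (phi : W -> 'rV[R]_k),
    [/\ open O /\ O p, open V, smooth_on V psi,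
        forall y, O y -> forall j, differentiable (fun z => phi z 0 j : R) y &
        psi @` V = M `&` O /\ forall x, V x -> phi (psi x) = x]) ->
  submanifold k M.
Proof.
move=> charts p /charts [] O [V [psi [phi [[oO Op] oV sV dphi [psiV phiK]]]]].
exists O, V, psi, phi; split=> //.
- move=> x v Vx psiv; apply/rowP => j; rewrite mxE.
  have [_ Ox] : (M `&` O) (psi x) by rewrite -psiV; exists x.
  have dpsi : derivable psi x v by have [_ /(_ v)[/(_ x Vx)]] := sV 1%N.
  have := derive_comp dpsi (dphi _ Ox j).
  rewrite psiv linear0 => <-.
  have [idd idv] := is_derive_id x v.
  rewrite -[in LHS]idv derive_mx// mxE; apply: near_eq_derive.
  near=> y; rewrite /= phiK//; near: y; exact: open_nbhs_nbhs.
- split=> //; apply: continuous_in_subspaceT => y /set_mem[_ Oy].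
  apply: cvg_mxP => i j; rewrite (ord1 i).
  exact: (differentiable_continuous (dphi _ Oy j)).
Unshelve. all: by end_near. Qed.

End Chart.

(** Explicit ordinals compute, so that entries of matrices given by lists reduce under [/=];
    [inord], used by [bianchi], is translated into them by [inord3]. *)
Local Notation o0 := (@Ordinal 3 0 isT).
Local Notation o1 := (@Ordinal 3 1 isT).
Local Notation o2 := (@Ordinal 3 2 isT).

(** * Explicit algebra of 3 x 3 matrices *)

Section Matrix3.
Context {F : comNzRingType}.
Implicit Types A B : 'M[F]_3.

Lemma ord3P (P : 'I_3 -> Prop) : P o0 -> P o1 -> P o2 -> forall i, P i.
Proof.
by move=> P0 P1 P2 [[|[|[|n]]] ni] //;
  [move: P0|move: P1|move: P2]; congr P; apply: val_inj.
Qed.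

Lemma sum3 (V : nmodType) (f : 'I_3 -> V) : \sum_i f i = f o0 + f o1 + f o2.
Proof.
rewrite !big_ord_recl big_ord0 addr0 addrA.
by congr (f _ + f _ + f _); apply: val_inj.
Qed.

Lemma mulmx3 A B i j :
  (A *m B) i j = A i o0 * B o0 j + A i o1 * B o1 j + A i o2 * B o2 j.
Proof. by rewrite mxE sum3. Qed.

Lemma mxtrace3 A : \tr A = A o0 o0 + A o1 o1 + A o2 o2.
Proof. by rewrite /mxtrace sum3. Qed.

Lemma det_mx22 (A : 'M[F]_2) :
  \det A = A 0 0 * A 1 1 - A 0 1 * A 1 0.
Proof.
rewrite (expand_det_row _ 0) !big_ord_recl big_ord0 /cofactor !det_mx11 !mxE /=.
rewrite addr0 !addn0 expr0 mul1r expr1 mulN1r mulrN.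
by congr (A _ _ * A _ _ - A _ _ * A _ _); apply: val_inj.
Qed.

Lemma det_mx33 A : \det A =
    A o0 o0 * (A o1 o1 * A o2 o2 - A o1 o2 * A o2 o1)
  - A o0 o1 * (A o1 o0 * A o2 o2 - A o1 o2 * A o2 o0)
  + A o0 o2 * (A o1 o0 * A o2 o1 - A o1 o1 * A o2 o0).
Proof.
rewrite (expand_det_row _ o0) sum3 /cofactor !det_mx22 !mxE /=.
have -> : lift o0 0 = o1 by apply: val_inj.
have -> : lift o0 1 = o2 by apply: val_inj.
have -> : lift o1 0 = o0 by apply: val_inj.
have -> : lift o1 1 = o2 by apply: val_inj.
have -> : lift o2 0 = o0 by apply: val_inj.
have -> : lift o2 1 = o1 by apply: val_inj.
by rewrite !addn0 !add0n; ring.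
Qed.

Definition mx3 (s : seq F) : 'M[F]_3 := \matrix_(i, j) s`_(3 * i + j).

Lemma matrix3P A B :
  [/\ A o0 o0 = B o0 o0, A o0 o1 = B o0 o1 & A o0 o2 = B o0 o2] ->
  [/\ A o1 o0 = B o1 o0, A o1 o1 = B o1 o1 & A o1 o2 = B o1 o2] ->
  [/\ A o2 o0 = B o2 o0, A o2 o1 = B o2 o1 & A o2 o2 = B o2 o2] -> A = B.
Proof.
by move=> [? ? ?] [? ? ?] [? ? ?]; apply/matrixP; elim/ord3P; elim/ord3P.
Qed.

End Matrix3.

(** * Matrix equation of the automorphism group *)

Section Automorphisms.
Context {R : realType}.
Implicit Types (g : 'M[R]_3) (a b : 'cV[R]_3).

Definition dmx (m1 m2 m3 : R) : 'M[R]_3 := mx3 [:: m1; 0; 0; 0; m2; 0; 0; 0; m3].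

Definition cross a b : 'cV[R]_3 := bianchi 1 1 1 a b.

Lemma inord3 : [/\ inord 0 = o0, inord 1 = o1 & inord 2 = o2 :> 'I_3].
Proof. by split; apply: val_inj; rewrite /= inordK. Qed.

Lemma bianchi_cross m1 m2 m3 a b :
  bianchi m1 m2 m3 a b = dmx m1 m2 m3 *m cross a b.
Proof.
apply/matrixP; elim/ord3P => j; rewrite (ord1 j) /cross /bianchi;
  have [-> -> ->] := inord3; rewrite !mxE sum3 !mxE /=; ring.
Qed.

(** Paired with a vector c, both sides give det(gc, ga, gb) = det(g) det(c, a, b). *)
Lemma trmx_cross g a b : g^T *m cross (g *m a) (g *m b) = \det g *: cross a b.
Proof.
apply/matrixP; elim/ord3P => j; rewrite (ord1 j) /cross /bianchi;
  have [-> -> ->] := inord3; rewrite det_mx33 !(mxE, sum3) /=; ring.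
Qed.

Lemma cross_basis i : exists a b : 'cV[R]_3, cross a b = delta_mx i 0.
Proof.
have [e12 e23 e31] := @bianchi_e R 1 1 1; move: e12 e23 e31.
have [-> -> ->] := inord3; rewrite !scale1r => e12 e23 e31.
by elim/ord3P: i; eexists; eexists; [exact: e23|exact: e31|exact: e12].
Qed.

Lemma cross_mulmx g a b : g \in unitmx ->
  cross (g *m a) (g *m b) = \det g *: (invmx g^T *m cross a b).
Proof.
by move=> gu; rewrite scalemxAr -trmx_cross mulKmx// unitmx_tr.
Qed.

Lemma eq_mulmx_cross (A B : 'M[R]_3) :
  (forall a b, A *m cross a b = B *m cross a b) -> A = B.
Proof.
move=> AB; apply/matrixP => i j; have [a [b abj]] := cross_basis j.
by have /matrixP/(_ i 0) := AB a b; rewrite abj -!colE !mxE.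
Qed.

Lemma AutP m1 m2 m3 g : Aut (bianchi m1 m2 m3) g <->
  g \in unitmx /\ g *m dmx m1 m2 m3 *m g^T = \det g *: dmx m1 m2 m3.
Proof.
set D := dmx _ _ _; split=> -[gu gC]; split=> //.
  have gtu : invmx g^T \in unitmx by rewrite unitmx_inv unitmx_tr.
  apply: (can_inj (mulmxK gtu)).
  rewrite -!mulmxA mulmxV ?unitmx_tr// mulmx1 -scalemxAl.
  apply: eq_mulmx_cross => a b.
  (* Evaluation at (ga, gb) cancels the inverses in [act]. *)
  have := congr1 (fun C : bracket => C (g *m a) (g *m b)) gC.
  rewrite /act !mulKmx// !bianchi_cross -/D mulmxA => ->.
  by rewrite cross_mulmx// -scalemxAr mulmxA !scalemxAl.
apply/funext => a; apply/funext => b; rewrite /act !bianchi_cross -/D.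
rewrite -[in RHS](mulKVmx gu a) -[in RHS](mulKVmx gu b) [in RHS]cross_mulmx//.
rewrite -[in RHS]scalemxAr [in RHS]scalemxAl [in RHS]mulmxA -gC mulmxK ?unitmx_tr//.
by rewrite mulmxA.
Qed.

End Automorphisms.

(** * Smoothness of real and matrix-valued functions *)

Section SmoothOn.
Context {R : realType} {U : normedModType R}.
Variables (V : set U) (oV : open V).
Implicit Types f g : U -> R.

Lemma eq_smooth f g : f =1 g -> smooth_on V g -> smooth_on V f.
Proof. by move=> /funext ->. Qed.

Lemma smooth_cst (c : R) : smooth_on V (fun _ => c).
Proof. by move=> k; exact: class_C_cst. Qed.

Lemma smoothD f g : smooth_on V f -> smooth_on V g ->
  smooth_on V (fun x => f x + g x).
Proof. by move=> sf sg k; exact: class_CD. Qed.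

Lemma smoothM f g : smooth_on V f -> smooth_on V g ->
  smooth_on V (fun x => f x * g x).
Proof. by move=> sf sg k; exact: class_CM. Qed.

Lemma smoothN f : smooth_on V f -> smooth_on V (fun x => - f x).
Proof.
move=> sf; rewrite (_ : (fun x => - f x) = fun x => -1 * f x).
  by apply: smoothM => //; exact: smooth_cst.
by apply/funext => x; rewrite mulN1r.
Qed.

Lemma smoothV f : (forall x, V x -> f x != 0) -> smooth_on V f ->
  smooth_on V (fun x => (f x)^-1).
Proof. by move=> f0 sf k; exact: class_CV. Qed.

Lemma smooth_mx m n (f : U -> 'M[R]_(m, n)) :
  (forall i j, smooth_on V (fun x => f x i j : R)) -> smooth_on V f.
Proof. by move=> sf k; apply/class_C_mxP => // i j; exact: sf. Qed.

Lemma smooth_mx3 (s : U -> seq R) :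
  (forall j : nat, smooth_on V (fun x => (s x)`_j)) ->
  smooth_on V (fun x => mx3 (s x)).
Proof.
move=> ss; apply: smooth_mx => i j.
by under eq_fun do rewrite mxE; exact: ss.
Qed.

Lemma smooth_mulmx3 (f g : U -> 'M[R]_3) :
  (forall i j, smooth_on V (fun x => f x i j : R)) ->
  (forall i j, smooth_on V (fun x => g x i j : R)) ->
  forall i j, smooth_on V (fun x => (f x *m g x) i j : R).
Proof.
move=> sf sg i j; apply: eq_smooth => [x|]; first exact: mulmx3.
by do 2?apply: smoothD; apply: smoothM.
Qed.

End SmoothOn.

Lemma smooth_coord {R : realType} m n (V : set 'M[R]_(m, n)) i j :
  smooth_on V (fun x : 'M[R]_(m, n) => x i j : R).
Proof. by move=> k; exact: class_C_coord. Qed.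

Lemma open_neq_smooth {R : realType} {U : normedModType R} (f : U -> R) (c : R) :
  smooth_on setT f -> open [set x | f x != c].
Proof.
move=> sf; apply: (@open_comp _ _ f [set y | y != c]); last exact: open_neq.
by move=> x _; apply: continuous_smooth.
Qed.

Definition coordinate {R : realType} n (v : 'rV[R]_n.+1) (j : nat) : R :=
  v 0 (inord j).

Lemma row_coordinate {R : realType} n (v : 'rV[R]_n.+1) :
  \row_j (mkseq (coordinate v) n.+1)`_j = v.
Proof.
by apply/rowP => j; rewrite mxE nth_mkseq// /coordinate inord_val.
Qed.

Lemma coordinate_row {R : realType} n (s : seq R) (j : nat) : (j < n.+1)%N ->
  coordinate (\row_(j < n.+1) s`_j) j = s`_j.
Proof. by move=> jn; rewrite /coordinate mxE inordK. Qed.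

Ltac smooth := repeat first
  [ exact: smooth_cst | exact: smooth_coord | exact: openT
  | apply: smoothD | apply: smoothM | apply: smoothN ].

(** * Automorphism groups for degenerate D: types I, II, VI_0 and VII_0 *)

Section Dimension.
Context {R : realType}.
Local Notation dim k m1 m2 m3 := (submanifold k (Aut (@bianchi R m1 m2 m3))).

Lemma AutIP (g : 'M[R]_3) : Aut (bianchi 0 0 0) g <-> g \in unitmx.
Proof.
rewrite AutP (_ : dmx 0 0 0 = 0) ?mulmx0 ?mul0mx ?scaler0; first by split=> [[]|].
by apply: matrix3P; rewrite !mxE.
Qed.

Lemma submanifold_AutI : dim 9 0 0 0.
Proof.
apply: submanifold_charts => p /AutIP pu.
have oGL : open [set g : 'M[R]_3 | g \in unitmx].
  rewrite (_ : mkset _ = [set g | \det g != 0]).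
    apply: open_neq_smooth; apply: eq_smooth; [by move=> ?; exact: det_mx33|smooth].
  by apply/seteqP; split=> g /=; rewrite unitmxE unitfE.
pose vec (v : 'rV[R]_9) : 'M[R]_3 := vec_mx (v : 'rV[R]_(3 * 3)).
exists [set g | g \in unitmx], [set v | vec v \in unitmx], vec, mxvec.
have svec A : open A -> smooth_on A vec.
  move=> oA; apply: smooth_mx => // i j.
  by under eq_fun do rewrite mxE; exact: smooth_coord.
have oV : open [set v | vec v \in unitmx].
  apply: (@open_comp _ _ vec [set g | g \in unitmx]) => // v _.
  by apply: continuous_smooth; exact: svec openT.
split=> //.
- exact: svec.
- move=> g _ j; case: (@mxvec_indexP 3 3 j) => i' j'.
  rewrite (_ : (fun z => _) = fun z : 'M[R]_3 => z i' j').
    exact: differentiable_coord.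
  by apply/funext => z; exact: mxvecE.
- split; last by move=> v _; exact: (@vec_mxK R 3 3 v).
  apply/seteqP; split=> [g [v vu <-]|g [/AutIP gu _]].
    by split=> //; exact/AutIP.
  by exists (mxvec g); rewrite /= /vec (@mxvecK R 3 3).
Qed.

(** For D = diag(1, 0, 0), g D g^T is the product of the first column of g with its transpose. Its
    lower diagonal entries are squares that must vanish, and the corner gives g00^2 = det(g) = g00
    d, where g00 can be cancelled. *)
Lemma AutIIP (g : 'M[R]_3) : Aut (bianchi 1 0 0) g <->
  let d := g o1 o1 * g o2 o2 - g o1 o2 * g o2 o1 in
  [/\ g o1 o0 = 0, g o2 o0 = 0, g o0 o0 = d & d != 0].
Proof.
rewrite AutP unitmxE unitfE; split=> /=.
  move=> [g0 E].
  have e i j : g i o0 * g j o0 = (\det g *: dmx 1 0 0) i j.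
    by rewrite -E mulmx3 !mulmx3 !mxE /=; ring.
  have g1 : g o1 o0 = 0.
    by apply/eqP; rewrite -[_ == 0]orbb -mulf_eq0 e !mxE /= mulr0.
  have g2 : g o2 o0 = 0.
    by apply/eqP; rewrite -[_ == 0]orbb -mulf_eq0 e !mxE /= mulr0.
  have gd : \det g = g o0 o0 * (g o1 o1 * g o2 o2 - g o1 o2 * g o2 o1).
    by rewrite det_mx33 g1 g2; ring.
  have g00 : g o0 o0 != 0 by apply: contraNneq g0 => g00; rewrite gd g00 mul0r.
  have /(mulfI g00) g0d : g o0 o0 * g o0 o0 =
      g o0 o0 * (g o1 o1 * g o2 o2 - g o1 o2 * g o2 o1).
    by rewrite e -gd !mxE /= mulr1.
  by split=> //; rewrite -g0d.
move=> [g1 g2 g0 d0].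
have gd : \det g = g o0 o0 * g o0 o0 by rewrite det_mx33 g1 g2 g0; ring.
split; first by rewrite gd mulf_neq0// g0.
by rewrite gd; apply: matrix3P; rewrite !mulmx3 !mxE /= ?g1 ?g2; split; ring.
Qed.

Lemma submanifold_AutII : dim 6 1 0 0.
Proof.
apply: submanifold_charts => p Mp.
pose d (v : 'rV[R]_6) := coordinate v 2 * coordinate v 5
  - coordinate v 3 * coordinate v 4.
have sd : smooth_on setT d by smooth.
have oV := open_neq_smooth 0 sd.
exists setT, [set v | d v != 0],
  (fun v => let x := coordinate v in
     mx3 [:: d v; x 0%N; x 1%N; 0; x 2%N; x 3%N; 0; x 4%N; x 5%N]),
  (fun g : 'M[R]_3 => \row_j [:: g o0 o1; g o0 o2; g o1 o1; g o1 o2; g o2 o1; g o2 o2]`_j).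
split=> //.
- by split=> //; exact: openT.
- apply: smooth_mx3 => // j; do 9 (case: j => [|j] /=; first by smooth); smooth.
- move=> g _ j; under eq_fun do rewrite mxE.
  by case: j => -[|[|[|[|[|[|]]]]]]//= _; exact: differentiable_coord.
- split; last by move=> v _; rewrite -[RHS]row_coordinate !mxE.
  apply/seteqP; split=> [g [v vd <-]|g [/AutIIP/=[g1 g2 g0 d0] _]].
    by split=> //; apply/AutIIP; rewrite /= !mxE.
  exists (\row_j [:: g o0 o1; g o0 o2; g o1 o1; g o1 o2; g o2 o1; g o2 o2]`_j);
    rewrite /= /d !coordinate_row//=.
  by apply: matrix3P; rewrite !mxE /= ?g1 ?g2 ?g0.
Qed.

(* The entries of [g diag(1, e) g^T = l diag(1, e)] for [g = [[a, b], [c, d]]]. *)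
Lemma conformal22 (e a b c d l : R) : e ^+ 2 = 1 ->
  a ^+ 2 + e * b ^+ 2 = l -> a * c + e * (b * d) = 0 ->
  c ^+ 2 + e * d ^+ 2 = e * l ->
  let D := a * d - b * c in
  [/\ D ^+ 2 = l ^+ 2, d * l = a * D & c * l = - (e * b) * D].
Proof.
move=> e2 al ac cl D.
split.
- suff : e * D ^+ 2 = e * l ^+ 2.
    move/(congr1 (fun x => e * x)); rewrite !mulrA -expr2 e2 !mul1r//.
  have : e * l ^+ 2 = (a ^+ 2 + e * b ^+ 2) * (c ^+ 2 + e * d ^+ 2).
    by rewrite al cl; ring.
  (* Brahmagupta's identity for the form x^2 + e y^2. *)
  have -> : (a ^+ 2 + e * b ^+ 2) * (c ^+ 2 + e * d ^+ 2) =
     (a * c + e * (b * d)) ^+ 2 + e * D ^+ 2 by rewrite /D; ring.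
  by rewrite ac => ->; ring.
(* The row (c, d) is orthogonal to (a, b), hence proportional to (-e b, a), with factor D / l. *)
- have -> : d * l = a * D + b * (a * c + e * (b * d)) by rewrite -al /D; ring.
  by rewrite ac; ring.
- have -> : c * l = - (e * b) * D + a * (a * c + e * (b * d)).
    by rewrite -al /D; ring.
  by rewrite ac; ring.
Qed.

(* VI_0 is [e = -1] and VII_0 is [e = 1]. *)
Lemma AutVIP (e : R) (g : 'M[R]_3) : e ^+ 2 = 1 ->
  Aut (bianchi 1 e 0) g <->
  let t := g o2 o2 in
  [/\ g o2 o0 = 0, g o2 o1 = 0 & t ^+ 2 = 1] /\
  [/\ g o1 o0 = - t * e * g o0 o1, g o1 o1 = t * g o0 o0 &
      g o0 o0 ^+ 2 + e * g o0 o1 ^+ 2 != 0].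
Proof.
move=> e2; rewrite AutP unitmxE unitfE; split=> /=.
  move=> [g0 E].
  have h i j : g i o0 * g j o0 + e * (g i o1 * g j o1)
      = \det g * (dmx 1 e 0) i j.
    by have /matrixP/(_ i j) := E; rewrite mulmx3 !mulmx3 !mxE /= => <-; ring.
  set l := \det g in g0 h.
  have [] := @conformal22 e (g o0 o0) (g o0 o1) (g o1 o0) (g o1 o1) l e2.
  - by rewrite !expr2 h !mxE /= mulr1.
  - by rewrite h !mxE /= mulr0.
  - by rewrite !expr2 h !mxE /= mulrC.
  set D := _ - _ => D2 dl cl.
  have D0 : D != 0 by rewrite -sqrf_eq0 D2 sqrf_eq0.
  have h0 : g o2 o0 * g o0 o0 + e * (g o2 o1 * g o0 o1) = 0.
    by rewrite h !mxE /= mulr0.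
  have h1 : g o2 o0 * g o1 o0 + e * (g o2 o1 * g o1 o1) = 0.
    by rewrite h !mxE /= mulr0.
  (* The pair (g20, g21) is orthogonal, for diag(1, e), to both rows of the upper left block. As D
     != 0, Cramer's rule makes it vanish. *)
  have g20 : g o2 o0 = 0.
    apply: (mulfI D0); rewrite mulr0.
    transitivity (g o1 o1 * (g o2 o0 * g o0 o0 + e * (g o2 o1 * g o0 o1))
       - g o0 o1 * (g o2 o0 * g o1 o0 + e * (g o2 o1 * g o1 o1))).
      by rewrite /D; ring.
    by rewrite h0 h1; ring.
  have g21 : g o2 o1 = 0.
    apply: (mulfI D0); rewrite mulr0.
    transitivity (e * (g o0 o0 * (g o2 o0 * g o1 o0 + e * (g o2 o1 * g o1 o1))
       - g o1 o0 * (g o2 o0 * g o0 o0 + e * (g o2 o1 * g o0 o1)))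
       (* Cramer's rule produces e^2 D g21; this term, zero in the end, turns it into D g21 as an
          identity for [ring]. *)
       + (1 - e ^+ 2) * D * g o2 o1).
      by rewrite /D; ring.
    by rewrite h0 h1 e2; ring.
  have lD : l = D * g o2 o2 by rewrite /l det_mx33 g20 g21 /D; ring.
  (* Compare l = D t with D^2 = l^2. *)
  have t2 : g o2 o2 ^+ 2 = 1.
    apply: (mulfI (expf_neq0 2 D0)); rewrite -exprMn -lD mulr1 //.
  have Dl : D = g o2 o2 * l by rewrite lD mulrCA -expr2 t2 mulr1.
  split; split=> //.
  - by apply: (mulIf g0); rewrite cl Dl; ring.
  - by apply: (mulIf g0); rewrite dl Dl; ring.
  - by rewrite !expr2 h !mxE /= mulr1.
move=> [[g20 g21 t2] [g10 g11 l0]].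
have gd : \det g = g o0 o0 ^+ 2 + e * g o0 o1 ^+ 2.
  rewrite -[RHS]mul1r -t2 det_mx33 g20 g21 g10 g11; ring.
split; first by rewrite gd.
have E1 i j : (g *m dmx 1 e 0 *m g^T) i j = g i o0 * g j o0 + e * (g i o1 * g j o1).
  by rewrite mulmx3 !mulmx3 !mxE /=; ring.
apply: matrix3P; rewrite !E1 !mxE /= gd ?g20 ?g21 ?g10 ?g11; split; try ring.
transitivity (g o2 o2 ^+ 2 * (e ^+ 2 * g o0 o1 ^+ 2 + e * g o0 o0 ^+ 2)); first ring.
by rewrite t2; ring.
Qed.

(** The lower right entry of an automorphism is 1 or -1. The open condition [g o2 o2 != - t]
    therefore keeps exactly those that share this entry with [p], and on them the first row and the
    entry [g o1 o2] are coordinates. *)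
Lemma submanifold_AutVI (e : R) : e ^+ 2 = 1 -> dim 4 1 e 0.
Proof.
move=> e2; apply: submanifold_charts => p /AutVIP -/(_ e2)/=[[_ _]].
set t := p o2 o2 => t2 _.
have tN : t != - t.
  by rewrite -subr_eq0 opprK -mulr2n mulrn_eq0/= -sqrf_eq0 t2 oner_neq0.
pose d (v : 'rV[R]_4) := coordinate v 0 ^+ 2 + e * coordinate v 1 ^+ 2.
have sd : smooth_on setT d by rewrite /d; smooth.
have oV := open_neq_smooth 0 sd.
exists [set g | g o2 o2 != - t], [set v | d v != 0],
  (fun v => let x := coordinate v in
     mx3 [:: x 0%N; x 1%N; x 2%N; - t * e * x 1%N; t * x 0%N; x 3%N; 0; 0; t]),
  (fun g : 'M[R]_3 => \row_j [:: g o0 o0; g o0 o1; g o0 o2; g o1 o2]`_j).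
split=> //.
- by split=> //; apply: open_neq_smooth; exact: smooth_coord.
- apply: smooth_mx3 => // j; do 9 (case: j => [|j] /=; first by smooth); smooth.
- move=> g _ j; under eq_fun do rewrite mxE.
  by case: j => -[|[|[|[|]]]]//= _; exact: differentiable_coord.
- split; last by move=> v _; rewrite -[RHS]row_coordinate !mxE.
  apply/seteqP; split=> [g [v vd <-]|g [/AutVIP -/(_ e2)/=[[g20 g21 g2] [g10 g11 l0]] gt]].
    by split; [apply/AutVIP => //; rewrite /= !mxE|rewrite /= !mxE].
  have gt' : g o2 o2 = t.
    apply/eqP; move: g2; rewrite -t2 => /eqP; rewrite eqf_sqr => /orP[//|].
    by rewrite (negbTE gt).
  exists (\row_j [:: g o0 o0; g o0 o1; g o0 o2; g o1 o2]`_j);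
    rewrite /= /d !coordinate_row//=.
  by apply: matrix3P; rewrite !mxE /= ?g10 ?g11 ?g20 ?g21 ?gt'.
Qed.

End Dimension.

(** * Types VIII and IX: Cayley chart on the special orthogonal group of J *)

Section Orthogonal.
Context {R : realType}.
Variables (e : R) (e2 : e ^+ 2 = 1).
Implicit Types (g : 'M[R]_3) (v : 'rV[R]_3).
Let J : 'M[R]_3 := dmx 1 1 e.

(* VIII is [e = -1] and IX is [e = 1]. *)
Lemma AutVIIIP g : Aut (bianchi 1 1 e) g <-> g *m J *m g^T = J /\ \det g = 1.
Proof.
have e0 : e != 0 by rewrite -sqrf_eq0 e2 oner_neq0.
have detJ : \det J = e by rewrite det_mx33 !mxE /=; ring.
rewrite AutP unitmxE unitfE -/J; split=> [[g0 gJ]|[gJ g1]]; last first.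
  by rewrite gJ g1 scale1r oner_neq0.
suff g1 : \det g = 1 by rewrite gJ g1 scale1r.
(* Determinants give det(g)^2 e = det(g)^3 e, the cube coming from scaling a 3 x 3 matrix. *)
have /(congr1 (@determinant R 3)) := gJ.
rewrite !det_mulmx det_tr detZ detJ => E.
apply: (mulfI (mulf_neq0 (mulf_neq0 g0 g0) e0)).
have -> : \det g * \det g * e * 1 = \det g * e * \det g by ring.
by rewrite E; ring.
Qed.

Lemma JJ : J *m J = 1%:M.
Proof. by apply: matrix3P; rewrite !mulmx3 !mxE /= -?expr2 ?e2; split; ring. Qed.

(** The sum of the principal 2 x 2 minors, that is, the linear coefficient of the characteristic
    polynomial. *)
Definition minors2 g : R :=
    (g o0 o0 * g o1 o1 - g o0 o1 * g o1 o0)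
  + (g o0 o0 * g o2 o2 - g o0 o2 * g o2 o0)
  + (g o1 o1 * g o2 o2 - g o1 o2 * g o2 o1).

(* The adjoint for the bilinear form [J], using [J^-1 = J]. *)
Definition adjoint g : 'M[R]_3 := J *m g^T *m J.

Lemma adjointE g i j : adjoint g i j = J i i * J j j * g j i.
Proof.
by rewrite /adjoint; elim/ord3P: i; elim/ord3P: j; rewrite !mulmx3 !mxE /=; ring.
Qed.

Lemma trace_adjoint g : \tr (adjoint g) = \tr g.
Proof. by rewrite /adjoint mxtrace_mulC mulmxA JJ mul1mx mxtrace_tr. Qed.

Lemma mulmx_adjoint g : g *m J *m g^T = J <-> g *m adjoint g = 1%:M.
Proof.
rewrite /adjoint !mulmxA; split=> [->|]; first exact: JJ.
by move=> /(congr1 (mulmx^~ J)); rewrite -mulmxA JJ mulmx1 mul1mx.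
Qed.

Lemma Cayley_Hamilton33 g :
  g *m g *m g - \tr g *: (g *m g) + minors2 g *: g = (\det g)%:M.
Proof.
apply: matrix3P; rewrite !(mxE, sum3) mxtrace3 det_mx33 /minors2 /=;
  split; ring.
Qed.

(** Newton's identity for the second elementary symmetric function of the eigenvalues. *)
Lemma minors2E g : 2 * minors2 g = (\tr g) ^+ 2 - \tr (g *m g).
Proof. by rewrite /minors2 !mxtrace3 !mulmx3; ring. Qed.

(** Multiply Cayley-Hamilton by g^-1 = [adjoint g]. With t = tr(g) and m = [minors2 g], traces give
    tr(g^2) = t^2 - 3m + t, and Newton's 2m = t^2 - tr(g^2) then yields m = t. *)
Lemma sqr_adjoint g : g *m adjoint g = 1%:M -> \det g = 1 ->
  g *m g = \tr g *: g - (\tr g)%:M + adjoint g.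
Proof.
move=> gh g1; have hg := mulmx1C gh.
have CH : g *m g = \tr g *: g - (minors2 g)%:M + adjoint g.
  have /(congr1 (mulmx^~ (adjoint g))) := Cayley_Hamilton33 g.
  rewrite g1 mul1mx !mulmxDl mulNmx -!scalemxAl -!(mulmxA _ _ (adjoint g)).
  rewrite gh !mulmx1 => <-; rewrite scalemx1.
  by apply/matrixP => i j; rewrite !mxE; ring.
suff st : minors2 g = \tr g by rewrite {1}CH st.
have := congr1 mxtrace CH; rewrite !linearD/= linearN/= mxtraceZ mxtrace_scalar.
rewrite trace_adjoint => E; have := minors2E g; rewrite E.
by move=> M; lra.
Qed.

Lemma sign_e : e = 1 \/ e = -1.
Proof. by move/eqP: e2; rewrite sqrf_eq1 => /orP[]/eqP; [left|right]. Qed.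

(** The Lie algebra of the orthogonal group of [J]: this is the matrix of the cross product with v,
    multiplied on the right by [J]. *)
Definition skew v : 'M[R]_3 := let x := coordinate v in
  mx3 [:: 0; - x 2%N; e * x 1%N; x 2%N; 0; - e * x 0%N; - x 1%N; x 0%N; 0].

(** The common value of det(1 - A) and det(1 + A) for A = [skew v]; see [det_skew]. *)
Definition cayley_den v : R := let x := coordinate v in
  1 + e * (x 0%N ^+ 2 + x 1%N ^+ 2) + x 2%N ^+ 2.

(* [(1 + A) (1 - A)^-1] for [A = skew v], which satisfies [A^3 = (1 - d) A]. *)
Definition cayley v : 'M[R]_3 :=
  1%:M + (2 / cayley_den v) *: (skew v + skew v *m skew v).

(** If g = [cayley v], d = [cayley_den v] and A = [skew v], then [adjoint] sends A to -A, so g -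
    [adjoint g] = (4 / d) A, while 1 + tr(g) = 4 / d. The quotient is A, and v is read off from its
    entries. *)
Definition cayley_inv g : 'rV[R]_3 :=
  \row_j [:: (g o2 o1 - e * g o1 o2) / (1 + \tr g);
             (e * g o0 o2 - g o2 o0) / (1 + \tr g);
             (g o1 o0 - g o0 o1) / (1 + \tr g)]`_j.

(** Cayley-Hamilton: trace and determinant vanish, and [cayley_den v - 1] is the sum of the
    principal 2 x 2 minors. *)
Lemma skew3 v : skew v *m skew v *m skew v = (1 - cayley_den v) *: skew v.
Proof.
apply: matrix3P; rewrite !(mxE, sum3) /cayley_den /=; split; ring.
Qed.

Lemma skewJ v : skew v *m J = - (J *m (skew v)^T).
Proof.
by apply: matrix3P; rewrite !(mxE, sum3) /=; case: sign_e => ->; split; ring.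
Qed.

(** By [skew3], (1 - A)(A + A^2) = A - A^3 = d A, so the product is 1 - A + 2A. *)
Lemma cayleyM v : cayley_den v != 0 ->
  (1%:M - skew v) *m cayley v = 1%:M + skew v.
Proof.
move=> d0; rewrite /cayley mulmxDr mulmx1 -scalemxAr mulmxBl mul1mx mulmxDr.
rewrite mulmxA skew3; apply/matrixP => i j; rewrite !mxE; field.
exact: d0.
Qed.

Lemma det_skew v :
  \det (1%:M - skew v) = cayley_den v /\ \det (1%:M + skew v) = cayley_den v.
Proof. by rewrite !det_mx33 !mxE /cayley_den /=; split; ring. Qed.

(** Multiplying by 1 - A on the left and its transpose on the right reduces the claim to (1 + A) J
    (1 + A)^T = (1 - A) J (1 - A)^T. The two sides differ only in the terms linear in A, and these
    cancel by [skewJ]. The determinant is a quotient of equal numbers. *)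
Lemma cayley_orthogonal v : cayley_den v != 0 ->
  cayley v *m J *m (cayley v)^T = J /\ \det (cayley v) = 1.
Proof.
move=> d0; have [dm dp] := det_skew v; have gM := cayleyM d0; split; last first.
  have /(congr1 (@determinant R 3)) := gM.
  by rewrite det_mulmx dm dp -[RHS]mulr1 => /(mulfI d0).
have u : 1%:M - skew v \in unitmx by rewrite unitmxE unitfE dm.
have ut : (1%:M - skew v)^T \in unitmx by rewrite unitmx_tr.
apply: (can_inj (mulKmx u)); apply: (can_inj (mulmxK ut)).
rewrite !mulmxA gM -mulmxA -trmx_mul gM.
rewrite linearD linearB/= trmx1 !mulmxDr !mulmxDl !mulmxN !mulNmx !mul1mx !mulmx1.
rewrite skewJ; apply/matrixP => i j; rewrite !mxE; ring.
Qed.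

Lemma cayley_trace v : cayley_den v != 0 ->
  1 + \tr (cayley v) = 4 / cayley_den v.
Proof.
move=> d0; rewrite /cayley mxtraceD mxtrace1 mxtraceZ mxtraceD.
have -> : \tr (skew v) = 0 by rewrite mxtrace3 !mxE /=; ring.
have -> : \tr (skew v *m skew v) = 2 * (1 - cayley_den v).
  by rewrite mxtrace3 !(mxE, sum3) /cayley_den /=; ring.
by field.
Qed.

Lemma cayleyK v : cayley_den v != 0 -> cayley_inv (cayley v) = v.
Proof.
move=> d0; rewrite -[RHS]row_coordinate; apply/rowP => j; rewrite !mxE.
rewrite cayley_trace//.
case: j => -[|[|[|]]]//= _; rewrite /cayley !(mxE, sum3) /=;
  case: sign_e => ->; field; exact: d0.
Qed.

Lemma skew_cayley_inv g :
  skew (cayley_inv g) = (1 + \tr g)^-1 *: (g - adjoint g).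
Proof.
rewrite /skew !coordinate_row//=; apply: matrix3P; rewrite !(mxE, sum3) /=;
case: sign_e => ->; split; ring.
Qed.

(** Write h = [adjoint g] = g^-1 and t = tr(g). Applying [sqr_adjoint] to g and to h gives (g - h)^2
    = (1 + t)(g + h - 2). Hence A = (g - h) / (1 + t) has A^2 = (g + h - 2) / (1 + t) and A + A^2 =
    2 (g - 1) / (1 + t); since d = 4 / (1 + t), the Cayley formula returns g. *)
Lemma cayley_invK g : g *m J *m g^T = J -> \det g = 1 -> 1 + \tr g != 0 ->
  cayley_den (cayley_inv g) != 0 /\ cayley (cayley_inv g) = g.
Proof.
move=> /mulmx_adjoint gh g1 t0; have hg := mulmx1C gh.
have gg := sqr_adjoint gh g1.
have hK : adjoint (adjoint g) = g.
  apply/matrixP => i j; rewrite !adjointE.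
  by elim/ord3P: i; elim/ord3P: j; rewrite !mxE /=;
    first [ring | case: sign_e => ->; ring].
have h1 : \det (adjoint g) = 1.
  by have := congr1 (@determinant R 3) gh; rewrite det_mulmx g1 mul1r det1.
have hh : adjoint g *m adjoint g = \tr g *: adjoint g - (\tr g)%:M + g.
  by rewrite sqr_adjoint ?hK ?trace_adjoint.
have sq : (g - adjoint g) *m (g - adjoint g) =
    (1 + \tr g) *: (g + adjoint g - 2%:M).
  rewrite mulmxBl !mulmxBr gg hh gh hg.
  by apply/matrixP => i j; rewrite !mxE; ring.
have sk2 : skew (cayley_inv g) *m skew (cayley_inv g) =
    (1 + \tr g)^-1 *: (g + adjoint g - 2%:M).
  rewrite skew_cayley_inv -scalemxAl -scalemxAr sq !scalerA mulfVK//.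
have dE : cayley_den (cayley_inv g) = 4 / (1 + \tr g).
  (* The denominator is recovered from tr(A^2) = 2 (1 - d). *)
  have -> : cayley_den (cayley_inv g) =
      1 - \tr (skew (cayley_inv g) *m skew (cayley_inv g)) / 2.
    by rewrite mxtrace3 !(mxE, sum3) /cayley_den /=; field.
  rewrite sk2 mxtraceZ mxtraceD linearN/= mxtraceD trace_adjoint mxtrace_scalar.
  by field.
split; first by rewrite dE mulf_neq0// invr_neq0.
rewrite /cayley sk2 skew_cayley_inv dE -scalerDr scalerA.
apply/matrixP => i j; rewrite !mxE; field.
exact: t0.
Qed.

(** Translation by p^-1 moves p to the identity, where 1 + tr = 4. That the chart fills the whole
    part of the group with [t g != 0] follows from [cayley_trace] in one direction and [cayley_invK]
    in the other. *)
Lemma submanifold_AutVIII : submanifold 3 (Aut (@bianchi R 1 1 e)).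
Proof.
apply: submanifold_charts => p /AutVIIIP[pJ p1].
have pu : p \in unitmx by rewrite unitmxE p1 unitr1.
have sd : smooth_on setT cayley_den by rewrite /cayley_den; smooth.
have oV := open_neq_smooth 0 sd.
pose t g : R := 1 + \tr (invmx p *m g).
have st : smooth_on setT t.
  rewrite /t; apply: eq_smooth; first by move=> g; rewrite mxtrace3 !mulmx3.
  by smooth.
exists [set g | t g != 0], [set v | cayley_den v != 0],
  (fun v => p *m cayley v), (fun g => cayley_inv (invmx p *m g)).
have inH g : Aut (bianchi 1 1 e) (p *m g) <-> g *m J *m g^T = J /\ \det g = 1.
  rewrite AutVIIIP det_mulmx p1 mul1r trmx_mul.
  have -> : p *m g *m J *m (g^T *m p^T) = p *m (g *m J *m g^T) *m p^T.
    by rewrite !mulmxA.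
  have put : p^T \in unitmx by rewrite unitmx_tr.
  split=> -[E ->]; split=> //; last by rewrite E.
  by apply: (can_inj (mulKmx pu)); apply: (can_inj (mulmxK put)); rewrite E.
split=> //.
- split; first exact: open_neq_smooth.
  by rewrite /= /t mulVmx// mxtrace1 nat1r pnatr_eq0.
- apply: smooth_mx => // i j; apply: smooth_mulmx3 => // {}i {}j.
    exact: smooth_cst.
  have ssk i' j' : smooth_on [set v | cayley_den v != 0]
      (fun v => skew v i' j' : R).
    rewrite /skew; elim/ord3P: i'; elim/ord3P: j';
      (apply: eq_smooth => [v|]; [by rewrite mxE; reflexivity|by smooth]).
  apply: (@eq_smooth _ _ _ _ (fun v => (1%:M : 'M[R]_3) i j +
    2 / cayley_den v * (skew v i j + (skew v *m skew v) i j))) => [v|].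
    by rewrite /cayley mxE [X in _ + X]mxE [X in _ * X]mxE.
  apply: smoothD => //; first exact: smooth_cst.
  apply: smoothM => //.
    apply: smoothM => //; first exact: smooth_cst.
    by apply: smoothV => // k; have := sd k; apply: class_C_subset.
  by apply: smoothD => //; exact: smooth_mulmx3.
- move=> g tg j.
  have dm i' j' : differentiable (fun h : 'M[R]_3 => (invmx p *m h) i' j' : R) g.
    under eq_fun do rewrite mulmx3.
    by do 2?apply: differentiableD; apply: differentiableM => //;
      exact: differentiable_coord.
  have dt : differentiable (fun h => (t h)^-1) g.
    apply: differentiableV => //; rewrite /t.
    under eq_fun do rewrite mxtrace3.
    by do 3?apply: differentiableD.
  under eq_fun do rewrite mxE.
  case: j => -[|[|[|]]]//= _; apply: differentiableM => //;
    apply: differentiableB => //; exact: differentiableM.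
- split; last by move=> v vd; rewrite mulKmx// cayleyK.
  apply/seteqP; split=> [g [v vd <-]|g [Hg gt]].
    split; first by apply/inH; exact: cayley_orthogonal.
    by rewrite /= /t mulKmx// cayley_trace// mulf_neq0// invr_neq0.
  have /inH[gJ g1] : Aut (bianchi 1 1 e) (p *m (invmx p *m g)) by rewrite mulKVmx.
  have [d0 gE] := cayley_invK gJ g1 gt.
  by exists (cayley_inv (invmx p *m g)); rewrite ?gE ?mulKVmx.
Qed.

End Orthogonal.

(** * From entrywise equations to the block forms of the statement *)

Section Blocks.
Context {R : realType}.

Lemma block12E (a : 'M[R]_1) (b : 'M[R]_(1, 2)) (c : 'M[R]_(2, 1)) (d : 'M[R]_2) :
  block_mx a b c d = mx3 [:: a 0 0; b 0 0; b 0 1; c 0 0; d 0 0; d 0 1;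
                             c 1 0; d 1 0; d 1 1].
Proof.
have l0 : o0 = lshift 2 (0 : 'I_1) by apply: val_inj.
have r0 : o1 = rshift 1 (0 : 'I_2) by apply: val_inj.
have r1 : o2 = rshift 1 (1 : 'I_2) by apply: val_inj.
pose B : 'M[R]_3 := block_mx a b c d.
(* The entries of a block matrix are indexed by [lshift] and [rshift]; [E] passes from the explicit
   ordinals to these. *)
have E (i j i' j' : 'I_3) : i = i' -> j = j' -> B i j = B i' j' by move=> -> ->.
apply: matrix3P; split; rewrite [RHS]mxE /=.
- exact: etrans (E _ _ _ _ l0 l0) (block_mxEul a b c d 0 0).
- exact: etrans (E _ _ _ _ l0 r0) (block_mxEur a b c d 0 0).
- exact: etrans (E _ _ _ _ l0 r1) (block_mxEur a b c d 0 1).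
- exact: etrans (E _ _ _ _ r0 l0) (block_mxEdl a b c d 0 0).
- exact: etrans (E _ _ _ _ r0 r0) (block_mxEdr a b c d 0 0).
- exact: etrans (E _ _ _ _ r0 r1) (block_mxEdr a b c d 0 1).
- exact: etrans (E _ _ _ _ r1 l0) (block_mxEdl a b c d 1 0).
- exact: etrans (E _ _ _ _ r1 r0) (block_mxEdr a b c d 1 0).
- exact: etrans (E _ _ _ _ r1 r1) (block_mxEdr a b c d 1 1).
Qed.

Lemma block21E (a : 'M[R]_2) (b : 'M[R]_(2, 1)) (c : 'M[R]_(1, 2)) (d : 'M[R]_1) :
  block_mx a b c d = mx3 [:: a 0 0; a 0 1; b 0 0; a 1 0; a 1 1; b 1 0;
                             c 0 0; c 0 1; d 0 0].
Proof.
have l0 : o0 = lshift 1 (0 : 'I_2) by apply: val_inj.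
have l1 : o1 = lshift 1 (1 : 'I_2) by apply: val_inj.
have r0 : o2 = rshift 2 (0 : 'I_1) by apply: val_inj.
pose B : 'M[R]_3 := block_mx a b c d.
have E (i j i' j' : 'I_3) : i = i' -> j = j' -> B i j = B i' j' by move=> -> ->.
apply: matrix3P; split; rewrite [RHS]mxE /=.
- exact: etrans (E _ _ _ _ l0 l0) (block_mxEul a b c d 0 0).
- exact: etrans (E _ _ _ _ l0 l1) (block_mxEul a b c d 0 1).
- exact: etrans (E _ _ _ _ l0 r0) (block_mxEur a b c d 0 0).
- exact: etrans (E _ _ _ _ l1 l0) (block_mxEul a b c d 1 0).
- exact: etrans (E _ _ _ _ l1 l1) (block_mxEul a b c d 1 1).
- exact: etrans (E _ _ _ _ l1 r0) (block_mxEur a b c d 1 0).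
- exact: etrans (E _ _ _ _ r0 l0) (block_mxEdl a b c d 0 0).
- exact: etrans (E _ _ _ _ r0 l1) (block_mxEdl a b c d 0 1).
- exact: etrans (E _ _ _ _ r0 r0) (block_mxEdr a b c d 0 0).
Qed.

Lemma ord2P (P : 'I_2 -> Prop) : P 0 -> P 1 -> forall i, P i.
Proof.
by move=> P0 P1 [[|[|n]] ni] //; [move: P0|move: P1]; congr P; apply: val_inj.
Qed.

Lemma matrix2P (A B : 'M[R]_2) :
  [/\ A 0 0 = B 0 0, A 0 1 = B 0 1, A 1 0 = B 1 0 & A 1 1 = B 1 1] <-> A = B.
Proof.
split=> [[? ? ? ?]|->//]; apply/matrixP.
by elim/ord2P; elim/ord2P.
Qed.
Lemma I21E : I_ 2 1 = dmx 1 1 (-1) :> 'M[R]_3.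
Proof. by rewrite /I_ block21E; apply: matrix3P; rewrite !mxE. Qed.

Lemma I11E : let I := I_ 1 1 : 'M[R]_2 in
  [/\ I 0 0 = 1, I 0 1 = 0, I 1 0 = 0 & I 1 1 = -1].
Proof.
have l0 : (0 : 'I_2) = lshift 1 (0 : 'I_1) by apply: val_inj.
have r0 : (1 : 'I_2) = rshift 1 (0 : 'I_1) by apply: val_inj.
pose B : 'M[R]_2 := I_ 1 1.
have E (i j i' j' : 'I_2) : i = i' -> j = j' -> B i j = B i' j' by move=> -> ->.
split.
- by rewrite [LHS](etrans (E _ _ _ _ l0 l0) (block_mxEul _ _ _ _ 0 0)) !mxE.
- by rewrite [LHS](etrans (E _ _ _ _ l0 r0) (block_mxEur _ _ _ _ 0 0)) !mxE.
- by rewrite [LHS](etrans (E _ _ _ _ r0 l0) (block_mxEdl _ _ _ _ 0 0)) !mxE.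
- by rewrite [LHS](etrans (E _ _ _ _ r0 r0) (block_mxEdr _ _ _ _ 0 0)) !mxE.
Qed.

Lemma sum2 (V : nmodType) (f : 'I_2 -> V) : \sum_i f i = f 0 + f 1.
Proof.
rewrite !big_ord_recl big_ord0 addr0.
by congr (f _ + f _); apply: val_inj.
Qed.

Lemma mulmx2 m n (A : 'M[R]_(m, 2)) (B : 'M[R]_(2, n)) i j :
  (A *m B) i j = A i 0 * B 0 j + A i 1 * B 1 j.
Proof. by rewrite mxE sum2. Qed.

(** The relation defining CO(1,1) for [e = -1] and CO(2) for [e = 1], in the form consumed by
    [conformal22]. *)
Definition conformal (e l : R) (g : 'M[R]_2) : Prop :=
  [/\ g 0 0 ^+ 2 + e * g 0 1 ^+ 2 = l,
      g 0 0 * g 1 0 + e * (g 0 1 * g 1 1) = 0 &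
      g 1 0 ^+ 2 + e * g 1 1 ^+ 2 = e * l].

Lemma is_factorP (g : 'M[R]_2) l : is_factor g l <-> l != 0 /\ conformal (-1) l g.
Proof.
have := I11E; rewrite /is_factor /=; move: (I_ 1 1 : 'M[R]_2) => J [i00 i01 i10 i11].
suff : g *m J *m g^T = l *: J <-> conformal (-1) l g by move=> ->.
rewrite -matrix2P !mulmx2 !mxE i00 i01 i10 i11 /conformal.
by split=> [[? ? ? ?]|[? ? ?]]; split; nra.
Qed.

Lemma conformal1P (g : 'M[R]_2) l : g *m g^T = l *: 1%:M <-> conformal 1 l g.
Proof.
rewrite -matrix2P !mulmx2 !mxE /conformal /=.
by split=> [[? ? ? ?]|[? ? ?]]; split; nra.
Qed.

(** Here the conformal factor replaces the sign t as the parameter: l is the determinant of the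
    whole matrix, so the corner is l / det(g1), from which both VI_0 and VII_0 are read. *)
Lemma AutVI_blockP (e : R) (g1 : 'M[R]_2) c (t : 'M[R]_1) : e ^+ 2 = 1 ->
  Aut (bianchi 1 e 0) (block_mx g1 c 0 t) <->
  exists2 l, l != 0 & conformal e l g1 /\ \det g1 * t 0 0 = l.
Proof.
move=> e2; rewrite (AutVIP _ e2) block21E !mxE /= det_mx22; split.
  move=> [[_ _ t2] [g10 g11 l0]]; exists (g1 0 0 ^+ 2 + e * g1 0 1 ^+ 2) => //.
  have t2' : t 0 0 * t 0 0 = 1 by rewrite -expr2.
  rewrite /conformal g10 g11; split.
    split=> //; first by ring.
    transitivity (t 0 0 ^+ 2 * (e ^+ 2 * g1 0 1 ^+ 2 + e * g1 0 0 ^+ 2)); first ring.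
    by rewrite t2; ring.
  transitivity (t 0 0 ^+ 2 * (e * g1 0 1 ^+ 2 + g1 0 0 ^+ 2)); first ring.
  by rewrite t2; ring.
move=> [l l0 [[al ac cl] Dt]].
have := conformal22 e2 al ac cl.
set D := g1 0 0 * _ - _ in Dt *; move=> [D2 dl cl'].
have D0 : D != 0 by rewrite -sqrf_eq0 D2 sqrf_eq0.
have t2 : t 0 0 ^+ 2 = 1.
  by apply: (mulfI (expf_neq0 2 D0)); rewrite -exprMn Dt mulr1.
have Dl : D = t 0 0 * l by rewrite -Dt mulrCA -expr2 t2 mulr1.
do 2!split=> //.
- by apply: (mulIf l0); rewrite cl' Dl; ring.
- by apply: (mulIf l0); rewrite dl Dl; ring.
- by rewrite al.
Qed.

Lemma AutVI_block (e : R) (g : 'M[R]_(2 + 1)) : e ^+ 2 = 1 ->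
  Aut (bianchi 1 e 0) g ->
  exists (g1 : 'M[R]_2) (c : 'M[R]_(2, 1)) (t : 'M[R]_1), g = block_mx g1 c 0 t.
Proof.
move=> e2; rewrite -[g]submxK.
move: (ulsubmx g) (ursubmx g) (dlsubmx g) (drsubmx g) => g1 c d t.
rewrite (AutVIP _ e2) block21E !mxE /= => -[[d0 d1 _] _].
exists g1, c, t; rewrite -block21E; congr block_mx.
by apply/matrixP => i; elim/ord2P; rewrite (ord1 i) mxE.
Qed.

Lemma AutIIE : Aut (bianchi 1 0 0) =
  [set g : 'M[R]_(1 + 2) | exists (g2 : 'M[R]_2) (c : 'M[R]_(1, 2)),
     GL R 2 g2 /\ g = block_mx (\det g2)%:M c 0 g2].
Proof.
apply/seteqP; split=> g /=; last first.
  move=> [g2 [c [+ ->]]]; rewrite /GL /= unitmxE unitfE det_mx22 => d0.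
  by apply/AutIIP; rewrite block12E !mxE.
rewrite -[g](@submxK _ 1 2 1 2).
move: (ulsubmx _) (ursubmx _) (dlsubmx _) (drsubmx _) => a b c d.
rewrite AutIIP block12E !mxE /= -det_mx22 => -[c0 c1 a0 d0].
exists d, b; split; first by rewrite /GL/= unitmxE unitfE.
rewrite -block12E; congr block_mx; first by rewrite [LHS]mx11_scalar a0.
by apply/matrixP; elim/ord2P => j; rewrite (ord1 j) mxE.
Qed.

Lemma AutVI0E : Aut (bianchi 1 (- 1) 0) =
  [set g : 'M[R]_(2 + 1) | exists (g1 : 'M[R]_2) (c : 'M[R]_(2, 1)),
     CO11 R g1 /\ g = block_mx g1 c 0 (lambda g1 / \det g1)%:M].
Proof.
have e2 : (-1) ^+ 2 = 1 :> R by rewrite sqrrN expr1n.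
apply/seteqP; split=> g /=; last first.
  move=> [g1 [c [[g1u [l gl]] ->]]]; apply/AutVI_blockP => //.
  have /is_factorP[l0 lc] := gl.
  have d0 : \det g1 != 0 by move: g1u; rewrite /GL/= unitmxE unitfE.
  by exists l => //; split=> //; rewrite mxE mulr1n (lambdaP gl) mulrC divfK.
move=> Hg; have [g1 [c [t gE]]] := AutVI_block e2 Hg.
move: Hg; rewrite gE AutVI_blockP// => -[l l0 [lc dl]].
have gl : is_factor g1 l by apply/is_factorP.
have d0 : \det g1 != 0 by apply: contraNneq l0 => d0; rewrite -dl d0 mul0r.
exists g1, c; split.
  by split; [rewrite /GL/= unitmxE unitfE|exists l].
congr block_mx; rewrite [LHS]mx11_scalar (lambdaP gl) -dl mulrAC divff// mul1r//.
Qed.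

Lemma AutVII0E : Aut (bianchi 1 1 0) =
  [set g : 'M[R]_(2 + 1) | exists (g1 : 'M[R]_2) (c : 'M[R]_(2, 1)),
     CO2 R g1 /\ g = block_mx g1 c 0 (Num.sg (\det g1))%:M].
Proof.
have e2 : 1 ^+ 2 = 1 :> R by rewrite expr1n.
(* For e = 1 the factor l is a sum of squares, so D^2 = l^2 leaves only l = |D| and the corner l / D
   is the sign of D. *)
have pos l (g1 : 'M[R]_2) : l != 0 -> conformal 1 l g1 ->
    \det g1 != 0 /\ l = `|\det g1|.
  move=> l0 [al ac cl]; have [D2 _ _] := conformal22 e2 al ac cl.
  rewrite -det_mx22 in D2; split; first by rewrite -sqrf_eq0 D2 sqrf_eq0.
  have lp : 0 <= l by rewrite -al mul1r addr_ge0// sqr_ge0.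
  by apply/eqP; rewrite -(eqrXn2 (n := 2))// -normrX D2 ger0_norm// sqr_ge0.
apply/seteqP; split=> g /=; last first.
  move=> [g1 [c [[g1u [l [l0 /conformal1P lc]]] ->]]]; apply/AutVI_blockP => //.
  exists l => //; split=> //; have [_ ->] := pos _ _ l0 lc.
  by rewrite mxE mulr1n mulrC normrEsg.
move=> Hg; have [g1 [c [t gE]]] := AutVI_block e2 Hg.
move: Hg; rewrite gE AutVI_blockP// => -[l l0 [lc dl]].
have [d0 ld] := pos _ _ l0 lc.
exists g1, c; split.
  split; first by rewrite /GL/= unitmxE unitfE.
  by exists l; split=> //; apply/conformal1P.
congr block_mx; rewrite [LHS]mx11_scalar; congr (_%:M); apply: (mulfI d0).
by rewrite dl ld normrEsg mulrC.
Qed.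

Lemma AutVIIIE (e : R) : e ^+ 2 = 1 -> Aut (bianchi 1 1 e) =
  [set g | [/\ GL R 3 g, g *m dmx 1 1 e *m g^T = dmx 1 1 e & \det g = 1]].
Proof.
move=> e2; apply/seteqP; split=> g /=; rewrite (AutVIIIP e2); last by case.
by move=> [gJ g1]; split=> //; rewrite /GL/= unitmxE g1 unitr1.
Qed.

Lemma orbit_dimI (C : @bracket R) k d : submanifold k (Aut C) -> (d + k = 9)%N ->
  orbit_dim (orbit C) d.
Proof. by move=> CM dk; exists C, k. Qed.

End Blocks.

Theorem mainTheorem3 (R : realType) :
  let L := @bianchi R in
  [/\ (* I *)
      Aut (L 0 0 0) = GL R 3 /\ orbit_dim (orbit (L 0 0 0)) 0,
      (* II *)
      Aut (L 1 0 0) =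
        [set g : 'M[R]_(1 + 2) | exists (g2 : 'M[R]_2) (c : 'M[R]_(1, 2)),
           GL R 2 g2 /\ g = block_mx (\det g2)%:M c 0 g2] /\
      orbit_dim (orbit (L 1 0 0)) 3,
      (* VI_0 *)
      Aut (L 1 (- 1) 0) =
        [set g : 'M[R]_(2 + 1) | exists (g1 : 'M[R]_2) (c : 'M[R]_(2, 1)),
           CO11 R g1 /\ g = block_mx g1 c 0 (lambda g1 / \det g1)%:M] /\
      orbit_dim (orbit (L 1 (- 1) 0)) 5,
      (* VII_0 *)
      Aut (L 1 1 0) =
        [set g : 'M[R]_(2 + 1) | exists (g1 : 'M[R]_2) (c : 'M[R]_(2, 1)),
           CO2 R g1 /\ g = block_mx g1 c 0 (Num.sg (\det g1))%:M] /\
      orbit_dim (orbit (L 1 1 0)) 5 &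
      (* VIII *)
      (Aut (L 1 1 (- 1)) = SO21 R /\ orbit_dim (orbit (L 1 1 (- 1))) 6) /\
      (* IX *)
      (Aut (L 1 1 1) = SO3 R /\ orbit_dim (orbit (L 1 1 1)) 6)].
Proof.
have e1 : 1 ^+ 2 = 1 :> R by rewrite expr1n.
have eN1 : (-1) ^+ 2 = 1 :> R by rewrite sqrrN.
move=> L; rewrite /L; split; last split.
- split; last exact: orbit_dimI submanifold_AutI _.
  by apply/seteqP; split=> g /=; rewrite AutIP.
- split; first exact: AutIIE.
  exact: orbit_dimI submanifold_AutII _.
- split; first exact: AutVI0E.
  exact: orbit_dimI (submanifold_AutVI eN1) _.
- split; first exact: AutVII0E.
  exact: orbit_dimI (submanifold_AutVI e1) _.
- split; last exact: orbit_dimI (submanifold_AutVIII eN1) _.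
  by rewrite AutVIIIE// -I21E.
- split; last exact: orbit_dimI (submanifold_AutVIII e1) _.
  rewrite AutVIIIE// (_ : dmx 1 1 1 = 1%:M).
    by apply/seteqP; split=> g [gu gg g1]; split=> //; rewrite mulmx1 in gg *.
  by apply: matrix3P; rewrite !mxE.
Qed.
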